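(* Let $G$ be a finite group and let $A, B \leq G$ be subgroups such that $G$ is a central product of $A$ and $B$. Then $\mathcal{CD}(A)\cdot \mathcal{CD}(B) \subseteq \mathcal{CD}(G)$. Furthermore, the top element of $\mathcal{CD}(G)$ is equal to the product $T_A T_B$ of the top element $T_A$ of $\mathcal{CD}(A)$ and the top element $T_B$ of $\mathcal{CD}(B)$, and the bottom element of $\mathcal{CD}(G)$ is equal to the product $B_A B_B$ of the bottom element $B_A$ of $\mathcal{CD}(A)$ and the bottom element $B_B$ of $\mathcal{CD}(B)$.
   Context: A group $G$ is a central product of its subgroups $A$ and $B$ if $G = AB$ and $[A,B]=1$ (i.e. $ab=ba$ for all $a\in A$, $b\in B$). For a finite group $G$ and $H \leq G$, the Chermak--Delgado measure is $m_G(H) = |H|\cdot|\mathbf{C}_G(H)|$, where $\mathbf{C}_G(H)$ is the centralizer of $H$ in $G$; $m^*(G)$ denotes the maximum of $m_G(H)$ over all subgroups $H \leq G$; and the Chermak--Delgado lattice is $\mathcal{CD}(G) = \{H \leq G : m_G(H) = m^*(G)\}$. It is a sublattice of the subgroup lattice of $G$, hence has a greatest (top) and a least (bottom) element with respect to inclusion. The lattices $\mathcal{CD}(A)$ and $\mathcal{CD}(B)$ are defined with $A$, $B$ as ambient groups. $\mathcal{CD}(A)\cdot\mathcal{CD}(B) = \{XY : X \in \mathcal{CD}(A),\ Y\in\mathcal{CD}(B)\}$, where $XY=\{xy : x\in X, y\in Y\}$. *)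

(* Defs.v *)
From mathcomp Require Import all_boot all_fingroup.

Set Implicit Arguments.
Unset Strict Implicit.
Unset Printing Implicit Defensive.

Local Open Scope group_scope.

Section ChermakDelgado.

Variable gT : finGroupType.
Implicit Types G H K T : {group gT}.

Definition CDmeasure G H : nat := (#|H| * #|'C_G(H)|)%N.

Definition CDmax G : nat := \max_(H : {group gT} | H \subset G) CDmeasure G H.

Definition CD G : {set {group gT}} :=
  [set H : {group gT} | (H \subset G) && (CDmeasure G H == CDmax G)].

(* A product X * Y of subgroups is a priori only a subset of gT, so this is a
   family of subsets. *)
Definition mul_family (P Q : {set {group gT}}) : {set {set gT}} :=
  [set (X * Y)%g | X : {group gT} in P, Y : {group gT} in Q].

Definition is_top (P : {set {group gT}}) T : bool :=
  (T \in P) && [forall H in P, H \subset T].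

Definition is_bottom (P : {set {group gT}}) T : bool :=
  (T \in P) && [forall H in P, T \subset H].

Lemma CDmeasure_gt0 G H : (0 < CDmeasure G H)%N.
Proof. by rewrite muln_gt0 !cardG_gt0. Qed.

Lemma CDmeasure_le G H : H \subset G -> (CDmeasure G H <= CDmax G)%N.
Proof. by move=> sHG; apply: (leq_bigmax_cond (F := CDmeasure G)). Qed.

Lemma CD_neq0 G : exists H, H \in CD G.
Proof.
have [|H sHG eH] :=
  @eq_bigmax_cond _ [pred H : {group gT} | H \subset G] (CDmeasure G).
  by apply/card_gt0P; exists G; rewrite inE.
by exists H; rewrite !inE in sHG *; rewrite sHG /CDmax eH eqxx.
Qed.

Lemma CDmeasure_modular G H K :
  (CDmeasure G H * CDmeasure G K <=
   CDmeasure G (H :&: K)%G * CDmeasure G (H <*> K)%G)%N.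
Proof.
rewrite /CDmeasure mulnACA (mul_cardG H K) (mul_cardG 'C_G(H) 'C_G(K)).
have -> : 'C_G(H) :&: 'C_G(K) = 'C_G(H <*> K) by rewrite centY setIACA setIid.
have leHK : (#|(H * K)%g| <= #|H <*> K|)%N.
  by rewrite subset_leq_card // mul_subG ?joing_subl ?joing_subr.
have leC : (#|('C_G(H) * 'C_G(K))%g| <= #|'C_G(H :&: K)|)%N.
  by rewrite subset_leq_card // mul_subG // setIS // centS ?subsetIl ?subsetIr.
rewrite (mulnC #|(H * K)%g|) mulnACA.
by rewrite leq_mul ?leq_mul.
Qed.

Lemma CD_lattice G H K :
  H \in CD G -> K \in CD G -> ((H :&: K)%G \in CD G) && ((H <*> K)%G \in CD G).
Proof.
rewrite !inE => /andP[sHG /eqP mH] /andP[sKG /eqP mK].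
have sIG : (H :&: K)%G \subset G by rewrite subIset ?sHG.
have sJG : (H <*> K)%G \subset G by rewrite join_subG sHG.
have := CDmeasure_modular G H K; rewrite mH mK sIG sJG /= => le_mod.
have leI := CDmeasure_le sIG; have leJ := CDmeasure_le sJG.
have m_gt0 : (0 < CDmax G)%N by rewrite -mH CDmeasure_gt0.
rewrite !eqn_leq leI leJ /= -(leq_pmul2r m_gt0) -[X in _ && X](leq_pmul2l m_gt0).
by rewrite !(leq_trans le_mod) // leq_mul.
Qed.

Lemma CD_top_exists G : exists T, is_top (CD G) T.
Proof.
have [H0 CH0] := CD_neq0 G.
case: (@arg_maxnP _ H0 [in CD G] (fun H : {group gT} => #|H|) CH0) => T CT maxT.
exists T; apply/andP; split=> //; apply/forall_inP=> H CH.
have /andP[_ /maxT leJ] := CD_lattice CT CH.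
have /eqP-> : T :==: T <*> H by rewrite eqEcard joing_subl.
exact: joing_subr.
Qed.

Lemma CD_bottom_exists G : exists T, is_bottom (CD G) T.
Proof.
have [H0 CH0] := CD_neq0 G.
case: (@arg_minnP _ H0 [in CD G] (fun H : {group gT} => #|H|) CH0) => T CT minT.
exists T; apply/andP; split=> //; apply/forall_inP=> H CH.
have /andP[/minT leI _] := CD_lattice CT CH.
have /eqP<- : T :&: H :==: T by rewrite eqEcard subsetIl.
exact: subsetIr.
Qed.

(* Greatest and least elements for inclusion; they are unique, see CDtop_unique
   and CDbottom_unique. *)
Definition CDtop G : {group gT} := xchoose (CD_top_exists G).

Definition CDbottom G : {group gT} := xchoose (CD_bottom_exists G).

Lemma CDtopP G : is_top (CD G) (CDtop G).
Proof. exact: xchooseP (CD_top_exists G). Qed.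

Lemma CDbottomP G : is_bottom (CD G) (CDbottom G).
Proof. exact: xchooseP (CD_bottom_exists G). Qed.

Lemma CDtop_unique G T : is_top (CD G) T -> T = CDtop G.
Proof.
case/andP=> CT /forall_inP leT; case/andP: (CDtopP G) => CU /forall_inP leU.
by apply/val_inj/eqP; rewrite eqEsubset leU //= leT.
Qed.

Lemma CDbottom_unique G T : is_bottom (CD G) T -> T = CDbottom G.
Proof.
case/andP=> CT /forall_inP leT; case/andP: (CDbottomP G) => CU /forall_inP leU.
by apply/val_inj/eqP; rewrite eqEsubset leT //= leU.
Qed.

End ChermakDelgado.

(* Main.v *)
Require Import Defs.
From mathcomp Require Import all_boot all_fingroup.
From mathcomp Require Import center.

Set Implicit Arguments.
Unset Strict Implicit.

Local Open Scope group_scope.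

(** Write Z for the intersection of the factors A and B; it is central in G.
    For subgroups X of A and Y of B, the centralizer of X Y in G is the product
    of the centralizers of X in A and of Y in B.  If moreover X and Y contain Z,
    counting gives m_G(X Y) |Z|^2 = m_A(X) m_B(Y) (lemma CDmeasure_mul).
    Members of CD(A) and CD(B) contain the center of A, respectively of B, hence
    they contain Z, and m*(A) m*(B) <= m*(G) |Z|^2 follows.

    The converse inequality comes from comparing an arbitrary subgroup H of G
    with its projection to one factor and its intersection with the other.
    Let P = A :&: H B be the set of A-components of the elements of H.
    Since H / (H :&: B) and P / Z are both isomorphic to H B / B, we have
    |H| |Z| = |P| |H :&: B|.  Applying the same to C = 'C_G(H) with the
    roles of A and B exchanged, and using that
    C :&: A centralizes P while the projection of C to B centralizes H :&: B,
    gives m_G(H) |Z|^2 <= m_A(P) m_B(H :&: B) (lemma CDmeasure_proj).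

    Hence m*(G) |Z|^2 = m*(A) m*(B), so m_G(X Y) = m*(G) for X in CD(A) and
    Y in CD(B), which is the claimed inclusion.
    Moreover, when H is in CD(G) the last inequality is sharp, so the projection
    of H to A is in CD(A) and H :&: B is in CD(B) (lemma CD_cprod_proj), and by
    symmetry the same holds with A and B exchanged.  As H lies between
    (H :&: A) (H :&: B) and the product of its two projections, the extremal
    elements of CD(G) are the products of those of CD(A) and CD(B). *)

(** * Members of the Chermak-Delgado lattice *)

Lemma CD_sub (gT : finGroupType) (G H : {group gT}) : H \in CD G -> H \subset G.
Proof. by rewrite inE => /andP[]. Qed.

Lemma CD_measure (gT : finGroupType) (G H : {group gT}) :
  H \in CD G -> CDmeasure G H = CDmax G.
Proof. by rewrite inE => /andP[_ /eqP]. Qed.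

(** Joining the center to H does not change its centralizer, so a subgroup of
    maximal measure already contains the center. *)
Lemma center_sub_CD (gT : finGroupType) (G H : {group gT}) :
  H \in CD G -> 'Z(G) \subset H.
Proof.
move=> CH; have sHG := CD_sub CH.
have sJG : (H <*> 'Z(G))%G \subset G by rewrite join_subG sHG center_sub.
have := CDmeasure_le sJG; rewrite -(CD_measure CH) /CDmeasure /=.
have -> : 'C_G(H <*> 'Z(G)) = 'C_G(H).
  rewrite centY setIA; apply/setIidPl.
  by rewrite subIset // centsC subIset ?subxx ?orbT.
rewrite leq_pmul2r ?cardG_gt0 // => leJH.
have /eqP-> : H :==: H <*> 'Z(G) by rewrite eqEcard joing_subl.
exact: joing_subr.
Qed.

(** * Orders and centralizers in a central product *)

Section CentralProduct.

Variables (gT : finGroupType) (G A B : {group gT}).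
Hypothesis defG : A \* B = G.

Let defAB : A * B = G. Proof. by case/cprodP: defG. Qed.
Let cAB : B \subset 'C(A). Proof. by case/cprodP: defG. Qed.
Let sAG : A \subset G. Proof. by rewrite -defAB mulG_subl. Qed.
Let sBG : B \subset G. Proof. by rewrite -defAB mulG_subr. Qed.
Let nBG : G \subset 'N(B). Proof. by have [_ /andP[]] := cprod_normal2 defG. Qed.

Lemma joing_cprod_factor (H : {group gT}) : H \subset G -> H <*> B = H * B.
Proof. by move=> sHG; rewrite norm_joinEl // (subset_trans sHG). Qed.

Lemma joing_cprod (X Y : {group gT}) :
  X \subset A -> Y \subset B -> X <*> Y = X * Y.
Proof.
move=> sXA sYB.
by rewrite cent_joinEr // (subset_trans sYB) // (subset_trans cAB) ?centS.
Qed.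

Lemma cprod_capI_center : A :&: B \subset 'Z(A).
Proof. by rewrite subsetI subsetIl subIset // cAB orbT. Qed.

(** The quotients of H by H :&: B and of its projection A :&: H B by A :&: B
    are both isomorphic to H B / B. *)
Lemma card_cprod_proj (H : {group gT}) : H \subset G ->
  (#|H| * #|A :&: B| = #|A :&: (H <*> B)| * #|H :&: B|)%N.
Proof.
move=> sHG; have eHB := joing_cprod_factor sHG.
have ePB : (A :&: (H <*> B)) * B = H * B.
  rewrite setIC group_modr ?joing_subr // defAB -eHB; apply/setIidPl.
  by rewrite join_subG sHG.
have := mul_cardG (A :&: (H <*> B))%G B; rewrite /= ePB.
rewrite -setIA (setIidPr (joing_subr H B)) => eP.
have eH := mul_cardG H B.
apply/eqP; rewrite -(eqn_pmul2r (cardG_gt0 B)) mulnAC eH.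
by rewrite (mulnAC #|A :&: _|) eP mulnAC.
Qed.

(** B centralizes A, so an element of A that centralizes H centralizes H B, and
    in particular the projection of H. *)
Lemma cent_cprod_proj (H K : {group gT}) :
  H \subset 'C(K) -> K :&: A \subset 'C_A(A :&: (H <*> B)).
Proof.
move=> cHK; rewrite subsetI subsetIr (subset_trans _ (centS (subsetIr _ _))) //.
rewrite centY subsetI !(centsC (K :&: A)).
by rewrite (subset_trans cHK) ?(subset_trans cAB) ?centS ?subsetIl ?subsetIr.
Qed.

(** Since B centralizes X, an element a b of G centralizes X as soon as a does;
    likewise it centralizes Y as soon as b does. *)
Lemma cent_cprod_mul (X Y : {group gT}) : X \subset A -> Y \subset B ->
  'C_G(X * Y) = 'C_A(X) * 'C_B(Y).
Proof.
move=> sXA sYB.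
have cBX : B \subset 'C(X) by rewrite (subset_trans cAB) ?centS.
have cAY : A \subset 'C(Y) by rewrite centsC (subset_trans sYB).
have -> : 'C_G(X * Y) = 'C_G(X) :&: 'C_G(Y).
  by rewrite centM setIACA setIid.
have -> : 'C_G(X) = 'C_A(X) * B.
  by rewrite -defAB setIC -group_modr // setIC.
rewrite -group_modl; first by rewrite setIA (setIidPl sBG).
by rewrite subIset // subsetI sAG cAY.
Qed.

(** The products X Y and 'C_A(X) 'C_B(Y) both amalgamate A :&: B, whence the
    square. *)
Lemma CDmeasure_mul (X Y : {group gT}) :
    X \subset A -> Y \subset B -> A :&: B \subset X -> A :&: B \subset Y ->
  (CDmeasure G (X <*> Y) * #|A :&: B| ^ 2 = CDmeasure A X * CDmeasure B Y)%N.
Proof.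
move=> sXA sYB sZX sZY.
(* Used both for X, Y and for their centralizers. *)
have capI (U V : {group gT}) : U \subset A -> V \subset B ->
    A :&: B \subset U -> A :&: B \subset V -> U :&: V = A :&: B.
  by move=> sUA sVB sZU sZV; apply/eqP; rewrite eqEsubset setISS // subsetI sZU.
have sZCX : A :&: B \subset 'C_A(X).
  rewrite subsetI subsetIl subIset //.
  by rewrite (subset_trans cAB) ?centS ?orbT.
have sZCY : A :&: B \subset 'C_B(Y).
  rewrite subsetI subsetIr subIset //.
  by rewrite centsC (subset_trans sYB).
rewrite /CDmeasure /= joing_cprod // cent_cprod_mul //.
have := mul_cardG X Y; rewrite capI // => eXY.
have := mul_cardG 'C_A(X) 'C_B(Y); rewrite capI ?subsetIl // => eC.
by rewrite mulnACA eXY eC mulnACA -mulnn.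
Qed.

End CentralProduct.

Lemma cprod_sym (gT : finGroupType) (G A B : {group gT}) :
  A \* B = G -> B \* A = G.
Proof. by rewrite cprodC. Qed.

(** By card_cprod_proj the order of H splits into its projection to A and its
    intersection with B.  Splitting the centralizer C of H the opposite way, into
    C :&: A and its projection to B, matches each piece of H with a piece of C
    that centralizes it. *)
Lemma CDmeasure_proj (gT : finGroupType) (G A B H : {group gT}) :
    A \* B = G -> H \subset G ->
  (CDmeasure G H * #|A :&: B| ^ 2 <=
   CDmeasure A (A :&: (H <*> B)) * CDmeasure B (H :&: B))%N.
Proof.
move=> defG sHG; have defG' := cprod_sym defG.
pose C := 'C_G(H)%G.
have sCG : C \subset G by apply: subsetIl.
have eH := card_cprod_proj defG sHG.
have eC := card_cprod_proj defG' sCG.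
have cHC : H \subset 'C(C) by rewrite centsC subsetIr.
have sPC : C :&: A \subset 'C_A(A :&: (H <*> B)).
  exact: (cent_cprod_proj defG cHC).
have sCS : B :&: (C <*> A) \subset 'C_B(H :&: B).
  rewrite subsetI subsetIl centsC.
  have /(cent_cprod_proj defG') : C \subset 'C(H) by apply: subsetIr.
  by move/subset_trans; apply; apply: subsetIr.
rewrite (setIC B A) in eC.
rewrite -mulnn mulnACA /CDmeasure /= eH eC.
rewrite (mulnC #|B :&: _|) mulnACA.
by rewrite leq_mul // leq_mul // subset_leq_card.
Qed.

(** * The lattice of a central product *)

Section ChermakDelgadoCentralProduct.

Variables (gT : finGroupType) (G A B : {group gT}).
Hypothesis defG : A \* B = G.

Let sAG : A \subset G. Proof. by case/cprodP: defG => _ <- _; exact: mulG_subl. Qed.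
Let sBG : B \subset G. Proof. by case/cprodP: defG => _ <- _; exact: mulG_subr. Qed.

Lemma CDmeasure_mul_CD (X Y : {group gT}) : X \in CD A -> Y \in CD B ->
  (CDmeasure G (X <*> Y) * #|A :&: B| ^ 2 = CDmax A * CDmax B)%N.
Proof.
move=> CX CY; rewrite -(CD_measure CX) -(CD_measure CY).
apply: (CDmeasure_mul defG (CD_sub CX) (CD_sub CY)).
  exact: subset_trans (cprod_capI_center defG) (center_sub_CD CX).
rewrite setIC.
exact: subset_trans (cprod_capI_center (cprod_sym defG)) (center_sub_CD CY).
Qed.

Lemma CDmax_cprod : (CDmax G * #|A :&: B| ^ 2 = CDmax A * CDmax B)%N.
Proof.
apply/eqP; rewrite eqn_leq; apply/andP; split.
  have [H CH] := CD_neq0 G; rewrite -(CD_measure CH).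
  apply: leq_trans (CDmeasure_proj defG (CD_sub CH)) _.
  by rewrite leq_mul // CDmeasure_le ?subsetIl ?subsetIr.
have [[X CX] [Y CY]] := (CD_neq0 A, CD_neq0 B).
rewrite -(CDmeasure_mul_CD CX CY) leq_pmul2r ?expn_gt0 ?cardG_gt0 //.
apply: CDmeasure_le; rewrite join_subG.
by rewrite (subset_trans (CD_sub CX)) // (subset_trans (CD_sub CY)).
Qed.

Lemma mul_CD_cprod (X Y : {group gT}) :
  X \in CD A -> Y \in CD B -> (X <*> Y)%G \in CD G.
Proof.
move=> CX CY; rewrite inE join_subG.
rewrite (subset_trans (CD_sub CX)) // (subset_trans (CD_sub CY)) //=.
have := CDmeasure_mul_CD CX CY; rewrite -CDmax_cprod => /eqP.
by rewrite eqn_pmul2r ?expn_gt0 ?cardG_gt0.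
Qed.

(** By CDmax_cprod, an H of maximal measure makes the left-hand side of
    CDmeasure_proj equal to m*(A) m*(B); this leaves no slack in either factor of
    the right-hand side. *)
Lemma CD_cprod_proj (H : {group gT}) : H \in CD G ->
  (A :&: (H <*> B))%G \in CD A /\ (H :&: B)%G \in CD B.
Proof.
move=> CH; have := CDmeasure_proj defG (CD_sub CH).
rewrite (CD_measure CH) CDmax_cprod => le_max.
have sP : (A :&: (H <*> B))%G \subset A by apply: subsetIl.
have sS : (H :&: B)%G \subset B by apply: subsetIr.
have [leP leS] := (CDmeasure_le sP, CDmeasure_le sS).
have mA_gt0 : (0 < CDmax A)%N := leq_trans (CDmeasure_gt0 _ _) leP.
have mB_gt0 : (0 < CDmax B)%N := leq_trans (CDmeasure_gt0 _ _) leS.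
rewrite !inE sP sS !eqn_leq leP leS /=; split.
  by rewrite -(leq_pmul2r mB_gt0) (leq_trans le_max) // leq_mul.
by rewrite -(leq_pmul2l mA_gt0) (leq_trans le_max) // leq_mul.
Qed.

(** If h = a b is in H, then a = h b^-1 is in H B and b = a^-1 h is in H A. *)
Lemma sub_mul_cprod_proj (H : {group gT}) : H \subset G ->
  H \subset (A :&: (H <*> B)) * (B :&: (H <*> A)).
Proof.
move=> sHG; have [_ defAB _] := cprodP defG.
apply/subsetP=> h Hh; have : h \in A * B by rewrite defAB (subsetP sHG).
case/mulsgP=> a b Aa Bb def_h; rewrite def_h; apply: mem_mulg.
  rewrite inE Aa /= -(mulgK b a) -def_h groupM ?groupV //.
    by rewrite (subsetP (joing_subl _ _)).
  by rewrite (subsetP (joing_subr _ _)).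
rewrite inE Bb /= -(mulKg a b) -def_h groupM ?groupV //.
  by rewrite (subsetP (joing_subr _ _)).
by rewrite (subsetP (joing_subl _ _)).
Qed.

End ChermakDelgadoCentralProduct.

Unset Implicit Arguments.

Theorem theorem1 (gT : finGroupType) (G A B : {group gT})
    (sAG : A \subset G) (sBG : B \subset G) (defG : A \* B = G) :
  [/\ mul_family (CD A) (CD B) \subset [set (H : {set gT}) | H : {group gT} in CD G],
      CDtop G = CDtop A * CDtop B :> {set gT}
    & CDbottom G = CDbottom A * CDbottom B :> {set gT}].
Proof.
have defG' := cprod_sym defG.
split.
- apply/subsetP=> _ /imset2P[X Y CX CY ->].
  rewrite -(joing_cprod defG) ?CD_sub //.
  exact: (imset_f _ (mul_CD_cprod defG CX CY)).
- have [/andP[CA /forall_inP leA] /andP[CB /forall_inP leB]] := (CDtopP A, CDtopP B).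
  rewrite -(joing_cprod defG) ?CD_sub //.
  rewrite -(@CDtop_unique _ G (CDtop A <*> CDtop B)) //.
  rewrite /is_top (mul_CD_cprod defG) //=; apply/forall_inP=> H CH.
  have [CPA _] := CD_cprod_proj defG CH.
  have [CPB _] := CD_cprod_proj defG' CH.
  apply: subset_trans (sub_mul_cprod_proj defG (CD_sub CH)) _.
  by rewrite /= (joing_cprod defG (CD_sub CA) (CD_sub CB)) mulgSS ?leA ?leB.
have [/andP[CA /forall_inP leA] /andP[CB /forall_inP leB]] :=
  (CDbottomP A, CDbottomP B).
rewrite -(joing_cprod defG) ?CD_sub //.
rewrite -(@CDbottom_unique _ G (CDbottom A <*> CDbottom B)) //.
rewrite /is_bottom (mul_CD_cprod defG) //=; apply/forall_inP=> H CH.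
have [_ CSB] := CD_cprod_proj defG CH.
have [_ CSA] := CD_cprod_proj defG' CH.
rewrite join_subG (subset_trans (leA _ CSA)) ?subsetIl //.
by rewrite (subset_trans (leB _ CSB)) ?subsetIl.
Qed.
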